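(* Let $G$ be an $\mathcal{H}$ graph such that $G\not\cong K_{3,3}$. Then $G$ is pancyclic.
   Context: Let $K'''_{3,3}$ be the graph obtained from the complete bipartite graph $K_{3,3}$ with bipartition $\{a,b,c\}$, $\{x,y,z\}$ by adding the three edges $ab$, $bc$, $ac$. Attaching a fan of length $m\ge 1$ across a triangle with vertices $h,u,v$ with sides $hu$ and $hv$ means: if $m=1$, do nothing; if $m\ge 2$, delete the edge $uv$, add $m-1$ new vertices $w_1,\dots,w_{m-1}$, add the path $u,w_1,\dots,w_{m-1},v$, and join $h$ to each $w_i$ (equivalently, take the clique sum with a wheel across a triangle whose two spokes are identified with $hu,hv$, then delete the rim edge $uv$). For $p,q,r\ge 1$, $\mathcal{H}_1(p,q,r)$ is obtained from $K'''_{3,3}$ by attaching fans of lengths $p$, $q$, $r$ across the triangles $\{a,b,x\}$ with sides $ab,bx$; $\{b,c,y\}$ with sides $bc,by$; and $\{a,b,z\}$ with sides $ab,bz$, respectively. $\mathcal{H}_2(p,q,r)$ is obtained in the same way except that the fan across $\{a,b,z\}$ has sides $ab$ and $az$. (Such graphs have $p+q+r+3$ vertices.) An $\mathcal{H}$ graph is any $3$-connected non-planar graph obtained from some $\mathcal{H}_1(p,q,r)$ or $\mathcal{H}_2(p,q,r)$ ($p,q,r\ge 1$) by deleting edges (including these graphs themselves). A graph on $n$ vertices is pancyclic if it has a cycle of every length from $3$ to $n$. *)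

(* Defs.v *)
From mathcomp Require Import all_boot all_order all_algebra.
From mathcomp Require Import classical_sets reals topology normedtype.

Set Implicit Arguments.
Unset Strict Implicit.
Unset Printing Implicit Defensive.

Import Order.TTheory GRing.Theory Num.Theory.
Import numFieldNormedType.Exports.

Record sgraph := SGraph {
  vertex :> finType;
  adj : rel vertex;
  adj_sym : symmetric adj;
  adj_irr : irreflexive adj }.

Arguments adj {s}.

Definition isomorphic (G H : sgraph) : Prop :=
  exists2 f : G -> H, bijective f & forall u v, adj (f u) (f v) = adj u v.

(* [G] is, up to isomorphism, obtained from [H] by deleting edges (possibly
   none, and never vertices). *)
Definition edge_deletion (G H : sgraph) : Prop :=
  exists2 f : G -> H, bijective f & forall u v, adj u v -> adj (f u) (f v).

Definition k_connected (k : nat) (G : sgraph) : Prop :=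
  k < #|G| /\
  forall S : {set G}, #|S| < k ->
    forall u v, u \notin S -> v \notin S ->
      connect [rel s t | [&& s \notin S, t \notin S & adj s t]] u v.

(* [ucycle] on a sequence of at least three vertices is a cycle of the graph. *)
Definition pancyclic (G : sgraph) : Prop :=
  forall k, 3 <= k <= #|G| ->
    exists2 c : seq G, size c = k & ucycle adj c.

Section Planarity.

Local Open Scope ring_scope.

Variables (R : realType) (G : sgraph).

(* A drawing in the plane: distinct vertices are distinct points, the edge uv
   is the simple arc [arc u v] from [pos u] to [pos v] ([arc v u] being the
   same arc reversed), and the interior of an edge meets neither a vertex nor
   the interior of another edge. *)
Record plane_drawing (pos : G -> R * R) (arc : G -> G -> R -> R * R) : Prop := {
  pos_inj : injective pos;
  arc_continuous : forall u v, adj u v ->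
    {within `[0, 1]%classic, continuous (arc u v)}%classic;
  arc_inj : forall u v, adj u v -> {in `[0, 1] &, injective (arc u v)};
  arc_start : forall u v, adj u v -> arc u v 0 = pos u;
  arc_end : forall u v, adj u v -> arc u v 1 = pos v;
  arc_rev : forall u v (t : R), adj u v -> t \in `[0, 1] ->
    arc v u t = arc u v (1 - t);
  arc_vertex : forall u v w (t : R), adj u v -> t \in `]0, 1[ ->
    arc u v t <> pos w;
  arc_disjoint : forall u v u' v' (t t' : R), adj u v -> adj u' v' ->
    (u', v') \notin [:: (u, v); (v, u)] ->
    t \in `]0, 1[ -> t' \in `]0, 1[ -> arc u v t <> arc u' v' t' }.

Definition planar : Prop := exists pos arc, plane_drawing pos arc.

End Planarity.

Section Fan.

Variables (G : sgraph) (h u v : G) (m : nat).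

(* The vertex [inr i] is w_(i+1); there are m - 1 of them, so the edge uv is
   deleted exactly when there is one. *)
Definition fan_spoke_or_end (s : G) (i : 'I_m.-1) : bool :=
  [|| s == h, (s == u) && (i == 0 :> nat) | (s == v) && (i.+1 == m.-1)].

Definition fan_adj : rel (G + 'I_m.-1) := fun s t =>
  match s, t with
  | inl s, inl t =>
      adj s t && ~~ ((1 < m) && ((s, t) \in [:: (u, v); (v, u)]))
  | inl s, inr i | inr i, inl s => fan_spoke_or_end s i
  | inr i, inr j => (i.+1 == j) || (j.+1 == i)
  end.

Lemma fan_adj_sym : symmetric fan_adj.
Proof.
move=> [s|i] [t|j] //=; last exact: orbC.
by rewrite adj_sym !inE !xpair_eqE orbC ![(_ == _) && (t == _)]andbC.
Qed.

Lemma fan_adj_irr : irreflexive fan_adj.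
Proof. by move=> [s|i] /=; rewrite ?adj_irr // orbb eqn_leq ltnn. Qed.

(* The fan of length m across the triangle huv with sides hu and hv. *)
Definition attach_fan : sgraph := SGraph fan_adj_sym fan_adj_irr.

Definition old (s : G) : attach_fan := inl s.

End Fan.

Arguments old {G h u v m}.

(* The bipartition is {a, b, c} = [inl], {x, y, z} = [inr]. *)
Definition K33_adj : rel ('I_3 + 'I_3) := fun s t =>
  match s, t with
  | inl _, inr _ | inr _, inl _ => true
  | _, _ => false
  end.

Lemma K33_sym : symmetric K33_adj.
Proof. by move=> [s|s] [t|t]. Qed.

Lemma K33_irr : irreflexive K33_adj.
Proof. by move=> [s|s]. Qed.

Definition K33 : sgraph := SGraph K33_sym K33_irr.

Definition K33'''_adj : rel ('I_3 + 'I_3) := fun s t =>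
  match s, t with
  | inl i, inl j => i != j
  | _, _ => K33_adj s t
  end.

Lemma K33'''_sym : symmetric K33'''_adj.
Proof. by move=> [s|s] [t|t] //=; rewrite eq_sym. Qed.

Lemma K33'''_irr : irreflexive K33'''_adj.
Proof. by move=> [s|s] //=; rewrite eqxx. Qed.

Definition K33''' : sgraph := SGraph K33'''_sym K33'''_irr.

Definition va : K33''' := inl (@Ordinal 3 0 isT).
Definition vb : K33''' := inl (@Ordinal 3 1 isT).
Definition vc : K33''' := inl (@Ordinal 3 2 isT).
Definition vx : K33''' := inr (@Ordinal 3 0 isT).
Definition vy : K33''' := inr (@Ordinal 3 1 isT).
Definition vz : K33''' := inr (@Ordinal 3 2 isT).

(* Fans on abx (sides ba, bx) and bcy (sides bc, by), common to both families. *)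
Definition H0 (p q : nat) : sgraph :=
  @attach_fan (@attach_fan K33''' vb va vx p) (old vb) (old vc) (old vy) q.

Definition H1 (p q r : nat) : sgraph :=
  @attach_fan (H0 p q) (old (old vb)) (old (old va)) (old (old vz)) r.

Definition H2 (p q r : nat) : sgraph :=
  @attach_fan (H0 p q) (old (old va)) (old (old vb)) (old (old vz)) r.

Definition H_graph (R : realType) (G : sgraph) : Prop :=
  [/\ k_connected 3 G, ~ planar R G &
      exists p q r, [/\ 1 <= p, 1 <= q, 1 <= r &
        edge_deletion G (H1 p q r) \/ edge_deletion G (H2 p q r)]].

(* Main.v *)
(** Every vertex of [H1 p q r] or [H2 p q r] other than a, b, c has degree three,
    so in a 3-connected spanning subgraph only the edges ab, bc, ac can be
    missing. What remains contains three disjoint strands P (from a to x, then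
    c), Q (from c to y, then a) and R (from a or b to z, then c); each vertex of
    P and Q is also joined to b, and each vertex of R to whichever of a, b does
    not start R. The cycles b, P_p, c, Q_1, ..., Q_j have the lengths 4, ..., q+3,
    and the cycles b, P_i, ..., P_p, c, Q_1, ..., Q_q, a, R_1, ..., R_k (with the
    R-part reversed for [H2]) have the lengths q+5, ..., n. The lengths 3 and
    q+4 need a strand with at least two vertices or, if p = q = r = 1, an edge
    inside one side of the bipartition, which exists because the graph is not
    [K33]. *)
From mathcomp Require Import all_boot zify ring.
Require Import Defs.
From mathcomp Require Import reals.

Set Implicit Arguments.
Unset Strict Implicit.
Unset Printing Implicit Defensive.

(** * Minimum degree, and edges that cannot be deleted *)

Section MinimumDegree.

Variable G : sgraph.

(** If [v] had fewer than [k] neighbours, its neighbourhood would separate it from some further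
    vertex, since [G] has more than [k] vertices: a path from [v] avoiding the neighbourhood cannot
    take its first step. *)
Lemma k_connected_degree k (v : G) :
  k_connected k G -> k <= #|[set w | adj v w]|.
Proof.
move=> [cardG conn]; rewrite leqNgt; apply/negP => ltNk.
set N := [set w | adj v w] in ltNk.
have vN : v \notin N by rewrite inE adj_irr.
have [w] : exists w, w \notin v |: N.
  apply/existsP; apply: contraT; rewrite negb_exists => /forallP allN.
  have /subset_leq_card : [set: G] \subset v |: N.
    by apply/subsetP => x _; have := allN x; rewrite negbK.
  by rewrite cardsT cardsU1 vN; lia.
rewrite in_setU1 negb_or => /andP [wv wN].
have /connectP [[|x s] /=] := conn N ltNk v w vN wN.
  by move=> _ wE; rewrite wE eqxx in wv.
by rewrite inE; case/andP => /and3P [_ /negP + vx]; rewrite inE.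
Qed.

(** Under [f], the at least [k] neighbours of [g v] inject into the at most [k] entries of [s], so
    they fill [s] and every edge at [v] survives. *)
Lemma edge_deletion_keeps (H : sgraph) (f : G -> H) (g : H -> G) k (v : H) s :
  k_connected k G -> cancel f g -> cancel g f ->
  (forall u w, adj u w -> adj (f u) (f w)) ->
  (forall w, adj v w -> w \in s) -> size s <= k ->
  forall w, w \in s -> adj (g v) (g w).
Proof.
move=> conn fK gK fadj vs sk w ws.
have sub : [set f x | x in [set x | adj (g v) x]] \subset [set y in s].
  apply/subsetP => _ /imsetP [x + ->]; rewrite !inE => /fadj.
  by rewrite gK => /vs.
have /eqP eqs : [set f x | x in [set x | adj (g v) x]] == [set y in s].
  rewrite eqEcard sub card_imset; last exact: can_inj fK.
  rewrite (leq_trans _ (k_connected_degree _ conn)) // (leq_trans _ sk) //.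
  by rewrite cardsE card_size.
have : w \in [set y in s] by rewrite inE.
by rewrite -eqs => /imsetP [x + ->]; rewrite inE fK.
Qed.

End MinimumDegree.

Lemma path_rev (T : eqType) (e : rel T) (x y : T) s :
  symmetric e -> path e y (rcons (rev s) x) = path e x (rcons s y).
Proof.
move=> e_sym; have := rev_path e x (rcons s y).
rewrite last_rcons belast_rcons rev_cons => ->.
by apply: eq_path => u w; exact: e_sym.
Qed.

(** * Odd cycles when there is a spanning [K33] *)

Section CompleteBipartite.

Variables (G : sgraph) (A B : 'I_3 -> G).
Hypothesis inj_AB :
  injective (fun s : 'I_3 + 'I_3 => match s with inl i => A i | inr i => B i end).
Hypothesis adj_AB : forall i j, adj (A i) (B j).

Lemma odd_cycle_of_edge i j k :
  adj (A i) (A j) -> k = 3 \/ k = 5 ->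
  exists2 c : seq G, size c = k & ucycle adj c.
Proof.
move=> aij; have ij : i != j.
  by apply: contraTneq aij => ->; rewrite adj_irr.
have eqA i1 i2 : (A i1 == A i2) = (i1 == i2).
  by apply/eqP/eqP => [e|-> //]; apply: (@inl_inj _ 'I_3); exact: inj_AB.
have eqB i1 i2 : (B i1 == B i2) = (i1 == i2).
  by apply/eqP/eqP => [e|-> //]; apply: (@inr_inj 'I_3); exact: inj_AB.
have eqAB i1 i2 : (A i1 == B i2) = false.
  by apply/eqP => e; have := @inj_AB (inl i1) (inr i2) e.
have eqBA i1 i2 : (B i1 == A i2) = false by rewrite eq_sym eqAB.
have adj_BA i1 i2 : adj (B i1) (A i2) by rewrite adj_sym.
case=> ->; first by exists [:: A i; A j; B ord0];
  rewrite // /ucycle /= !inE eqA !eqAB aij adj_AB adj_BA (negPf ij).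
(* The 5-cycle visits all of side [A], so it needs the third index besides [i] and [j]. *)
have [l] : exists l, (l != i) && (l != j).
  apply/existsP; apply: contraT; rewrite negb_exists => /forallP allij.
  have /subset_leq_card : [set: 'I_3] \subset [set i; j].
    by apply/subsetP => l _; have := allij l; rewrite !inE negb_and !negbK.
  by rewrite cardsT card_ord cards2 ij.
case/andP=> li lj.
exists [:: A i; A j; B ord0; A l; B ord_max] => //.
rewrite /ucycle /= !inE !eqA !eqB !eqAB !eqBA aij !adj_AB !adj_BA (negPf ij).
by rewrite ![_ == l]eq_sym (negPf li) (negPf lj).
Qed.

End CompleteBipartite.

(** An edge inside either side yields the odd cycles; with no such edge, the injection from six
    vertices is an isomorphism between [K33] and [G]. *)
Lemma odd_cycle_K33 (G : sgraph) (A B : 'I_3 -> G) k :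
  injective
    (fun s : 'I_3 + 'I_3 => match s with inl i => A i | inr i => B i end) ->
  (forall i j, adj (A i) (B j)) -> #|G| = 6 -> ~ isomorphic G K33 ->
  k = 3 \/ k = 5 -> exists2 c : seq G, size c = k & ucycle adj c.
Proof.
set F := (X in injective X) => injF adj_AB cardG nK33 k35.
have [/existsP [i /existsP [j aij]]|nA] :=
    boolP [exists i, exists j, adj (A i) (A j)].
  exact: odd_cycle_of_edge injF adj_AB _ _ _ aij k35.
have [/existsP [i /existsP [j bij]]|nB] :=
    boolP [exists i, exists j, adj (B i) (B j)].
  apply: (@odd_cycle_of_edge G B A) bij k35 => [s t eqst|i' j'].
    (* Swapping the summands carries the injectivity hypothesis over to the exchanged sides. *)
    pose sw (s : 'I_3 + 'I_3) := match s with inl i => inr i | inr i => inl i end.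
    have swK : involutive sw by case.
    by apply: (can_inj swK); apply: injF; case: s t eqst => [?|?] [?|?].
  by rewrite adj_sym.
case: nK33.
have [|g FK gK] := inj_card_bij injF.
  by rewrite card_sum card_ord cardG.
have nAij i j : adj (A i) (A j) = false.
  by apply: contraNF nA => aij; apply/existsP; exists i; apply/existsP; exists j.
have nBij i j : adj (B i) (B j) = false.
  by apply: contraNF nB => bij; apply/existsP; exists i; apply/existsP; exists j.
exists (g : G -> K33); first by exists F.
move=> u v; rewrite -{2}(gK u) -{2}(gK v).
by case: (g u) (g v) => [i|i] [j|j] /=; rewrite ?nAij ?nBij ?adj_AB // adj_sym adj_AB.
Qed.

(** * Strands: paths joined to a common hub *)

Section Strand.

Variable G : sgraph.

(** The strand proper is [F 1], ..., [F m]; index 0 holds the outside vertex from which it starts.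
    [h] is the hub and [t] the vertex reached from the tip [F m]. *)
Definition strand (h t : G) (m : nat) (F : nat -> G) : Prop :=
  forall i, 0 < i <= m ->
    [/\ adj (F i) (F i.-1), adj (F i) h &
        adj (F i) (if i < m then F i.+1 else t)].

Variables (h t : G) (m : nat) (F : nat -> G).
Hypothesis strandF : strand h t m F.

Lemma strand_path j n : j + n <= m -> path adj (F j) (map F (iota j.+1 n)).
Proof.
elim: n j => //= n IHn j jnm; rewrite IHn ?andbT; last by lia.
by rewrite adj_sym; have [] := @strandF j.+1; first by lia.
Qed.

Lemma strand_last j n : last (F j) (map F (iota j.+1 n)) = F (j + n).
Proof. by elim: n j => [|n IHn] j; rewrite ?addn0 //= IHn addSnnS. Qed.

Lemma strand_hub i : 0 < i <= m -> adj (F i) h.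
Proof. by case/strandF. Qed.

Lemma strand_tip : 0 < m -> adj (F m) t.
Proof. by move=> m0; have [|_ _] := @strandF m; rewrite ?ltnn //; lia. Qed.

End Strand.

Lemma subseq_map_iota (T : eqType) (F : nat -> T) i n m :
  0 < i -> i + n <= m.+1 -> subseq (map F (iota i n)) (map F (iota 1 m)).
Proof.
move=> i0 inm; apply: map_subseq.
have -> : m = i.-1 + (n + (m.+1 - (i + n))) by lia.
rewrite !iotaD; have -> : 1 + i.-1 = i by lia.
exact: subseq_trans (prefix_subseq _ _) (suffix_subseq _ _).
Qed.

(** * Cycles of all lengths in a graph made of three strands *)

Section Frame.

Variables (G : sgraph) (a b c h : G) (p q r : nat) (P Q R : nat -> G).
Hypotheses (p0 : 0 < p) (q0 : 0 < q) (r0 : 0 < r).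
Hypotheses (P0 : P 0 = a) (Q0 : Q 0 = c).
Hypotheses (sP : strand b c p P) (sQ : strand b a q Q) (sR : strand h c r R).
Hypothesis R0 : R 0 = a /\ h = b \/ R 0 = b /\ h = a.
Hypothesis uniq_frame :
  uniq ([:: a; b; c] ++ map P (iota 1 p) ++ map Q (iota 1 q)
                     ++ map R (iota 1 r)).

(** Each cycle below uses some of [a], [b], [c] and one interval of each strand, so up to order it
    is a subsequence of the frame. Intervals start at a positive index because [P 0], [Q 0], [R 0]
    are among [a], [b], [c]. *)
Lemma frame_uniq msk i1 n1 i2 n2 i3 n3 (s : seq G) :
  perm_eq s (mask msk [:: a; b; c] ++ map P (iota i1 n1) ++ map Q (iota i2 n2)
                                   ++ map R (iota i3 n3)) ->
  [&& 0 < i1, 0 < i2 & 0 < i3] ->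
  [&& i1 + n1 <= p.+1, i2 + n2 <= q.+1 & i3 + n3 <= r.+1] ->
  uniq s.
Proof.
move=> /perm_uniq -> /and3P [i10 i20 i30] /and3P [le1 le2 le3].
apply: subseq_uniq uniq_frame.
by rewrite !cat_subseq ?subseq_map_iota // mask_subseq.
Qed.

Lemma path_Q j : j <= q -> path adj c (map Q (iota 1 j)).
Proof. by move=> jq; rewrite -Q0 (strand_path sQ). Qed.

Lemma last_Q j : last c (map Q (iota 1 j)) = Q j.
Proof. by rewrite -Q0 strand_last. Qed.

Lemma cycle_short k : 4 <= k <= q + 3 ->
  exists2 s : seq G, size s = k & ucycle adj s.
Proof.
move=> kq; exists (b :: P p :: c :: map Q (iota 1 (k - 3))).
  by rewrite /= size_map size_iota; lia.
apply/andP; split; last first.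
  apply: (@frame_uniq [:: false; true; true] p 1 1 (k - 3) 1 0); try lia.
  by apply/permP => e; rewrite /= !count_cat /=; ring.
rewrite /= rcons_path last_Q path_Q; last by lia.
rewrite (strand_tip sP) // (strand_hub sQ) ?andbT; last by lia.
by rewrite adj_sym (strand_hub sP) //; lia.
Qed.

(** This hides the difference between the two families: if [R] starts at [a], follow it forwards and
    step to the hub [b]; if it starts at [b], step from the hub [a] to [R k] and follow it
    backwards. *)
Lemma strand_R_path k : 0 < k <= r ->
  exists2 s : seq G, perm_eq s (map R (iota 1 k)) & path adj a (rcons s b).
Proof.
move=> kr; case: R0 => -[R0' hE].
  exists (map R (iota 1 k)) => //.
  rewrite rcons_path -R0' strand_last (strand_path sR); last by lia.
  by rewrite -hE (strand_hub sR) //; lia.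
exists (rev (map R (iota 1 k))); first by rewrite perm_rev.
rewrite path_rev; last exact: adj_sym.
rewrite rcons_path -R0' strand_last (strand_path sR); last by lia.
by rewrite -hE (strand_hub sR) //; lia.
Qed.

Lemma cycle_long k : q + 5 <= k <= p + q + r + 3 ->
  exists2 s : seq G, size s = k & ucycle adj s.
Proof.
move=> kq.
(* The cycle uses the last [d.+1] vertices of [P] and the first [e] of [R]. As [k] grows, [P] is
   exhausted first with [e = 1], and then [e] increases. *)
have [d [e [dp er kE]]] : exists d e, [/\ d < p, 0 < e <= r & k = q + 4 + d + e].
  have [le|gt] := leqP k (q + 4 + p).
    by exists (k - q - 5), 1; split; lia.
  by exists p.-1, (k - q - 3 - p); split; lia.
have [s perm_s path_s] := strand_R_path er.
exists (b :: map P (iota (p - d) d.+1) ++ c :: map Q (iota 1 q) ++ a :: s).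
  rewrite /= !size_cat /= !size_cat /= !size_map !size_iota (perm_size perm_s).
  by rewrite size_map size_iota; lia.
apply/andP; split; last first.
  apply: (@frame_uniq [:: true; true; true] (p - d) d.+1 1 q 1 e); try lia.
  apply/permP => f; rewrite /= !count_cat /= !count_cat /= (permP perm_s).
  ring.
rewrite /= rcons_cat /= rcons_cat /= cat_path strand_last (strand_path sP);
  last by lia.
rewrite subnK /=; last by lia.
rewrite cat_path path_Q // last_Q /= (strand_tip sQ) // path_s !andbT.
by rewrite (strand_tip sP) // adj_sym (strand_hub sP) //; lia.
Qed.

Lemma cycle_middle : (1 < p) || (1 < q) || (1 < r) ->
  exists2 s : seq G, size s = q + 4 & ucycle adj s.
Proof.
have [p2 _|p1] := ltnP 1 p.
  exists (b :: P p.-1 :: P p :: c :: map Q (iota 1 q)).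
    by rewrite /= size_map size_iota; lia.
  apply/andP; split; last first.
    apply: (@frame_uniq [:: false; true; true] p.-1 2 1 q 1 0); try lia.
    by apply/permP => f; rewrite /= !count_cat /= prednK //; ring.
  rewrite /= rcons_path path_Q // last_Q (strand_tip sP) //.
  rewrite (strand_hub sQ) ?andbT; last by lia.
  rewrite adj_sym (strand_hub sP) /=; last by lia.
  by rewrite adj_sym; case: (@sP p); first by lia.
have [r2 _|r1] := ltnP 1 r.
  (* The cycle closes whichever of [a], [b] is [h], since [Q q] is adjacent to both; the mask in the
     uniqueness proof selects [h] accordingly. *)
  exists (h :: R r.-1 :: R r :: c :: map Q (iota 1 q)).
    by rewrite /= size_map size_iota; lia.
  apply/andP; split; last first.
    apply: (@frame_uniq [:: h == a; h == b; true] 1 0 1 q r.-1 2); try lia.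
    have ab : a != b by case/andP: uniq_frame; rewrite !inE negb_or => /andP [].
    apply/permP => f; rewrite /= !count_cat /= prednK //.
    case: R0 => -[_ ->]; rewrite eqxx ?(negPf ab) 1?eq_sym ?(negPf ab) /=; lia.
  rewrite /= rcons_path path_Q // last_Q (strand_tip sR) //.
  rewrite adj_sym (strand_hub sR) /=; last by lia.
  rewrite adj_sym; case: (@sR r) => [|-> _ _]; first by lia.
  case: R0 => -[_ ->]; last exact: strand_tip sQ _.
  by rewrite (strand_hub sQ) //; lia.
rewrite /= orbF => q2.
have pE : p = 1 by lia.
have rE : r = 1 by lia.
(* Here only [Q] is long. All of [a], [b], [c], [P 1], [R 1] are used, and [Q] is left at [Q 2] for
   its hub [b], so exactly [Q 1] is skipped. *)
exists [:: b, P 1, c, R 1, a & rev (map Q (iota 2 q.-1))].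
  by rewrite /= size_rev size_map size_iota; lia.
apply/andP; split; last first.
  apply: (@frame_uniq [:: true; true; true] 1 1 2 q.-1 1 1); try lia.
  by apply/permP => f; rewrite /= count_rev !count_cat /=; ring.
have [aP bP cP] : [/\ adj (P 1) a, adj (P 1) b & adj (P 1) c].
  by move: (@sP 1); rewrite pE P0; exact.
have [aR hR cR] : [/\ adj (R 1) (R 0), adj (R 1) h & adj (R 1) c].
  by move: (@sR 1); rewrite rE; exact.
have aR1 : adj (R 1) a by case: R0 aR hR => -[-> ->].
rewrite /= adj_sym bP cP adj_sym cR aR1 path_rev /=; last exact: adj_sym.
have -> : iota 2 q.-1 = 2 :: iota 3 q.-2 by case: (q) q2 => [|[]].
rewrite /= rcons_path strand_last (strand_path sQ); last by lia.
have -> : 2 + q.-2 = q by lia.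
by rewrite (strand_tip sQ) // adj_sym (strand_hub sQ).
Qed.

Lemma strand_triangle (h' t' : G) m F :
  strand h' t' m F -> 1 < m -> uniq [:: h'; F 1; F 2] ->
  exists2 s : seq G, size s = 3 & ucycle adj s.
Proof.
move=> sF m2 uF; exists [:: h'; F 1; F 2] => //.
rewrite /ucycle uF andbT /= adj_sym !(strand_hub sF) ?andbT //; try lia.
by rewrite /= adj_sym; case: (sF 2).
Qed.

Lemma frame_triangle : (1 < p) || (1 < q) || (1 < r) ->
  exists2 s : seq G, size s = 3 & ucycle adj s.
Proof.
case/orP=> [/orP []|] m2.
- apply: (strand_triangle sP m2).
  by apply: (@frame_uniq [:: false; true; false] 1 2 1 0 1 0); rewrite //=; lia.
- apply: (strand_triangle sQ m2).
  by apply: (@frame_uniq [:: false; true; false] 1 0 1 2 1 0); rewrite //=; lia.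
- apply: (strand_triangle sR m2).
  case: R0 => -[_ ->].
    by apply: (@frame_uniq [:: false; true; false] 1 0 1 0 1 2); rewrite //=; lia.
  by apply: (@frame_uniq [:: true; false; false] 1 0 1 0 1 2); rewrite //=; lia.
Qed.

(** When every strand is a single vertex, each of [P 1], [Q 1], [R 1] is adjacent to all of [a],
    [b], [c], so [K33] spans [G]. *)
Lemma frame_odd_cycle k : p = 1 -> q = 1 -> r = 1 -> #|G| = 6 ->
  ~ isomorphic G K33 -> k = 3 \/ k = 5 ->
  exists2 s : seq G, size s = k & ucycle adj s.
Proof.
move=> pE qE rE cardG nK33 k35.
have [aP bP cP] : [/\ adj (P 1) a, adj (P 1) b & adj (P 1) c].
  by move: (@sP 1); rewrite pE P0; exact.
have [cQ bQ aQ] : [/\ adj (Q 1) c, adj (Q 1) b & adj (Q 1) a].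
  by move: (@sQ 1); rewrite qE Q0; exact.
have [aR hR cR] : [/\ adj (R 1) (R 0), adj (R 1) h & adj (R 1) c].
  by move: (@sR 1); rewrite rE; exact.
have [aR1 bR1] : adj (R 1) a /\ adj (R 1) b by case: R0 aR hR => -[-> ->].
pose L := [:: a; b; c; P 1; Q 1; R 1].
have uL : uniq L by move: uniq_frame; rewrite pE qE rE.
apply: (@odd_cycle_K33 G (fun i => nth a L i) (fun i => nth a L (3 + i))) nK33 k35 => //.
  move=> s t st.
  have eqi (i j : nat) :
      nth a L i = nth a L j -> i < 6 -> j < 6 -> i = j.
    by move=> /eqP + i6 j6; rewrite nth_uniq // => /eqP.
  case: s t st => [i|i] [j|j] /eqi E; have := ltn_ord i; have := ltn_ord j => lj li.
  - by congr inl; apply: val_inj; apply: E; apply: ltn_trans (ltn_ord _) _.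
  - by have ij := E (ltn_trans li (isT : 3 < 6)) lj; rewrite ij in li.
  - by have ij := E li (ltn_trans lj (isT : 3 < 6)); rewrite -ij in lj.
  - by congr inr; apply: val_inj; apply: (@addnI 3); exact: E.
by move=> [[|[|[|]]] //= _] [[|[|[|]]] //= _]; rewrite adj_sym.
Qed.

Lemma frame_pancyclic :
  #|G| = p + q + r + 3 -> ~ isomorphic G K33 -> pancyclic G.
Proof.
move=> cardG nK33 k; rewrite cardG => kn.
have [/andP [le4 leq3]|] := boolP (4 <= k <= q + 3).
  by apply: cycle_short; rewrite le4.
have [|lt5 n4] := leqP (q + 5) k; first by move=> *; apply: cycle_long; lia.
have {n4}k34 : k = 3 \/ k = q + 4 by lia.
have [big|small] := boolP ((1 < p) || (1 < q) || (1 < r)).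
  by case: k34 => ->; [exact: frame_triangle | exact: cycle_middle].
(* All strands have length 1 here, so [q + 4] is 5. *)
apply: frame_odd_cycle => //; lia.
Qed.

End Frame.

(** * Neighbourhoods after attaching a fan *)

Section FanNeighbours.

Variables (G : sgraph) (h u v : G) (m : nat).

(** Positions along the rim: 0 is [u], the positions strictly between 0 and [m] are the new
    vertices, and [insub] fails from [m] on, which gives [v]. *)
Definition fan_vertex (i : nat) : attach_fan h u v m :=
  if i is j.+1 then if insub j is Some k then inr k else old v else old u.

Lemma fan_vertexS (k : 'I_m.-1) : fan_vertex k.+1 = inr k.
Proof. by rewrite /= valK. Qed.

Lemma fan_vertex_last : 0 < m -> fan_vertex m = old v.
Proof.
move=> m0; have -> : fan_vertex m = fan_vertex m.-1.+1 by rewrite prednK.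
by rewrite /= insubF // ltnn.
Qed.

Lemma fan_vertex_old i s : 0 < i -> fan_vertex i = old s -> s = v.
Proof. by case: i => //= i _; case: insub => [k|] // [->]. Qed.

(** Used once per fan, this peels the vertices of the final graph down to those of [K33''']. *)
Lemma fan_cover (w : attach_fan h u v m) : 0 < m ->
  w \in map fan_vertex (iota 1 m) \/ exists2 s, w = old s & s != v.
Proof.
move=> m0; case: w => [s|k].
  have [->|sv] := eqVneq s v; [left|by right; exists s].
  by apply/mapP; exists m; rewrite ?fan_vertex_last // mem_iota; lia.
left; apply/mapP; exists k.+1; rewrite ?fan_vertexS // mem_iota.
by have := ltn_ord k; lia.
Qed.

Lemma card_attach_fan : #|attach_fan h u v m| = #|G| + m.-1.
Proof. by rewrite card_sum card_ord. Qed.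

Lemma old_neighbours (s : G) (l : seq G) :
  s \notin [:: h; u; v] -> (forall w, adj s w -> w \in l) ->
  forall w : attach_fan h u v m, adj (old s) w -> w \in map old l.
Proof.
rewrite !inE !negb_or => /and3P [sh su sv] sl [w|j] /=.
  by case/andP => /sl wl _; rewrite (map_f (@old G h u v m)).
by rewrite /fan_spoke_or_end (negPf sh) (negPf su) (negPf sv).
Qed.

End FanNeighbours.

Arguments fan_vertex {G h u v m} _ : simpl never.

(* An upper bound on the neighbourhoods, as opposed to the lower bound given by
   [strand]; 3-connectedness turns the former into the latter. *)
Definition strand_bound (G : sgraph) (h t : G) (m : nat) (F : nat -> G) : Prop :=
  forall i, 0 < i <= m -> forall w, adj (F i) w ->
    w \in [:: F i.-1; h; if i < m then F i.+1 else t].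

(** A new vertex sees its two rim neighbours and [h]. The vertex [v], whose neighbours were among
    [u], [h] and [t], merely exchanges [u] for the last new vertex, or keeps it when [m = 1]. *)
Lemma fan_strand (G : sgraph) (h u v t : G) m :
  0 < m -> u != v -> h != v -> (forall w, adj v w -> w \in [:: u; h; t]) ->
  @strand_bound (attach_fan h u v m) (old h) (old t) m fan_vertex.
Proof.
move=> m0 uv hv Nv i /andP [i0]; rewrite leq_eqVlt => /predU1P [->|im] w.
  rewrite ltnn fan_vertex_last //; case: w => [s|j] /=.
    case/andP=> /Nv + ns.
    rewrite !inE => /or3P [] /eqP sE; rewrite {}sE in ns *; last 2 first.
    - by rewrite eqxx orbT.
    - by rewrite eqxx !orbT.
    (* The edge between [v] and [u] survives only for [m = 1], where the preceding rim position is
       [u] itself. *)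
    move: ns; rewrite !inE !xpair_eqE !eqxx orbT andbT -leqNgt => m1.
    have -> : @fan_vertex G h u v m m.-1 = old u by case: (m) m1 => [|[]].
    by rewrite eqxx.
  rewrite /fan_spoke_or_end ![v == _]eq_sym (negPf uv) (negPf hv) /= => /andP [_ /eqP jE].
  have -> : @fan_vertex G h u v m m.-1 = inr j by rewrite -fan_vertexS jE.
  by rewrite inE eqxx.
have km : i.-1 < m.-1 by lia.
have [k iE] : exists k : 'I_m.-1, i = k.+1.
  by exists (Ordinal km); rewrite /= prednK.
rewrite iE in im *; rewrite fan_vertexS im.
case: w => [s|j] /=.
  case/or3P => [/eqP ->|/andP [/eqP -> /eqP k0]|/andP [/eqP -> /eqP kE]].
  - by rewrite !inE eqxx orbT.
  - by rewrite k0 !inE eqxx.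
  have -> : @fan_vertex G h u v m k.+2 = old v.
    by rewrite -fan_vertex_last // kE prednK.
  by rewrite !inE eqxx !orbT.
case/orP=> /eqP kE.
  have -> : @fan_vertex G h u v m k.+2 = inr j by rewrite kE fan_vertexS.
  by rewrite !inE eqxx !orbT.
have -> : @fan_vertex G h u v m k = inr j by rewrite -kE fan_vertexS.
by rewrite !inE eqxx.
Qed.

(** A fan alters only the neighbourhoods of [h], [u] and [v] among the old vertices, so a strand
    avoiding them keeps its bounds. *)
Lemma old_strand (G : sgraph) (h u v : G) m (h' t' : G) m' F :
  (forall i, 0 < i <= m' -> F i \notin [:: h; u; v]) ->
  strand_bound h' t' m' F ->
  @strand_bound (attach_fan h u v m) (old h') (old t') m' (fun i => old (F i)).
Proof.
move=> nF sF i im w /(old_neighbours (nF i im) (sF i im)).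
by rewrite /=; case: ifP.
Qed.

(** Three possible neighbours and minimum degree three leave no choice: all three edges are present
    in [G]. *)
Lemma strand_of_bound (G H : sgraph) (f : G -> H) (g : H -> G) h t m F :
  k_connected 3 G -> cancel f g -> cancel g f ->
  (forall u v, adj u v -> adj (f u) (f v)) ->
  strand_bound h t m F -> strand (g h) (g t) m (fun i => g (F i)).
Proof.
move=> conn fK gK fadj sF i im.
have kept := edge_deletion_keeps conn fK gK fadj (sF i im) isT.
split; [| |rewrite -(fun_if g)]; apply: kept; rewrite !inE eqxx ?orbT //.
Qed.

(** * The three strands of [H1] and [H2], and their transfer to [G] *)

Section FrameOfH.

Variables p q r : nat.
Hypotheses (p0 : 0 < p) (q0 : 0 < q) (r0 : 0 < r).

Lemma K33'''_neighbours (s : 'I_3) w :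
  @adj K33''' (inr s) w -> w \in [:: va; vb; vc].
Proof. by case: w => [[[|[|[|]]]]|] //. Qed.

Lemma K33'''_cover (s : K33''') :
  s != vx -> s != vy -> s != vz -> s \in [:: va; vb; vc].
Proof. by case: s => [[[|[|[|]]]]|[[|[|[|]]]]]. Qed.

(** The strand consists of new vertices and [vx], hence is disjoint from the triangle of the second
    fan; the third neighbour of [vx] is [vc]. *)
Lemma H0_strand_P :
  @strand_bound (H0 p q) (old (old vb)) (old (old vc)) p
    (fun i => old (fan_vertex i)).
Proof.
apply: old_strand => [i /andP [i0 _]|].
  by rewrite !inE; do 2?[apply/norP; split]; apply/eqP; move/(fan_vertex_old i0).
by apply: fan_strand => // w /K33'''_neighbours.
Qed.

Lemma H0_strand_Q :
  @strand_bound (H0 p q) (old (old vb)) (old (old va)) q fan_vertex.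
Proof.
apply: fan_strand => // w yw.
have y_out : vy \notin [:: vb; va; vx] by [].
have := old_neighbours y_out (@K33'''_neighbours _) yw.
by rewrite !inE => /or3P [] /eqP ->; rewrite eqxx ?orbT.
Qed.

Lemma H0_neighbours_z w :
  @adj (H0 p q) (old (old vz)) w ->
  w \in [:: old (old va); old (old vb); old (old vc)].
Proof.
have z_out : vz \notin [:: vb; va; vx] by [].
have z_out' :
  old vz \notin [:: old vb; old vc; old vy : attach_fan vb va vx p] by [].
exact: old_neighbours z_out' (old_neighbours z_out (@K33'''_neighbours _)) w.
Qed.

(* [H1] is the case [(h, u) = (b, a)] and [H2] the case [(h, u) = (a, b)]. *)
Variables h u : K33'''.
Hypothesis hu : (h = vb /\ u = va) \/ (h = va /\ u = vb).

Let H := @attach_fan (H0 p q) (old (old h)) (old (old u)) (old (old vz)) r.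

Lemma H_strand_P :
  @strand_bound H (old (old (old vb))) (old (old (old vc))) p
    (fun i => old (old (fan_vertex i))).
Proof.
apply: old_strand H0_strand_P => i /andP [i0 _].
rewrite !inE; apply/norP; split; [|apply/norP; split]; apply/eqP => -[].
- by move/(fan_vertex_old i0); case: hu => -[-> _].
- by move/(fan_vertex_old i0); case: hu => -[_ ->].
- by move/(fan_vertex_old i0).
Qed.

Lemma H_strand_Q :
  @strand_bound H (old (old (old vb))) (old (old (old va))) q
    (fun i => old (fan_vertex i)).
Proof.
apply: old_strand H0_strand_Q => i /andP [i0 _].
rewrite !inE; apply/norP; split; [|apply/norP; split]; apply/eqP.
- by move/(fan_vertex_old i0) => -[]; case: hu => -[-> _].
- by move/(fan_vertex_old i0) => -[]; case: hu => -[_ ->].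
- by move/(fan_vertex_old i0).
Qed.

Lemma H_strand_R :
  @strand_bound H (old (old (old h))) (old (old (old vc))) r fan_vertex.
Proof.
apply: fan_strand => //; first by case: hu => -[_ ->].
  by case: hu => -[-> _].
move=> w /H0_neighbours_z; rewrite !in_cons.
by case: hu => -[-> ->] wN; [exact: wN | rewrite orbCA; exact: wN].
Qed.

Definition H_vertices : seq H :=
  [:: old (old (old va)); old (old (old vb)); old (old (old vc))]
  ++ map (fun i => old (old (fan_vertex i))) (iota 1 p)
  ++ map (fun i => old (fan_vertex i)) (iota 1 q) ++ map fan_vertex (iota 1 r).

Lemma card_H : #|H| = p + q + r + 3.
Proof. by rewrite !card_attach_fan card_sum card_ord; lia. Qed.

Lemma mem_H_vertices w : w \in H_vertices.
Proof.
rewrite !mem_cat; case: (fan_cover w r0) => [->|[s -> sz]].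
  by rewrite !orbT.
case: (fan_cover s q0) => [sQ|[s' sE s'y]].
  have := map_f (@old _ _ _ _ r : _ -> H) sQ.
  by rewrite -map_comp => ->; rewrite !orbT.
subst s; case: (fan_cover s' p0) => [s'P|[s sE sx]].
  have := map_f ((@old _ _ _ _ r : _ -> H) \o old) s'P.
  by rewrite -map_comp => ->; rewrite !orbT.
subst s'; have sy : s != vy by apply: contraNneq s'y => ->.
have {}sz : s != vz by apply: contraNneq sz => ->.
have := map_f ((@old _ _ _ _ r : _ -> H) \o (old \o old)) (K33'''_cover sx sy sz).
by move=> ->.
Qed.

(** The list covers [H] and is no longer than the number of vertices, so it has no repetition. *)
Lemma uniq_H_vertices : uniq H_vertices.
Proof.
apply: (@leq_size_uniq _ (enum H)) => [||]; first exact: enum_uniq.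
  by move=> w _; exact: mem_H_vertices.
by rewrite -cardE card_H !size_cat !size_map !size_iota /=; lia.
Qed.

Lemma edge_deletion_pancyclic (G : sgraph) :
  k_connected 3 G -> edge_deletion G H -> ~ isomorphic G K33 -> pancyclic G.
Proof.
move=> conn [f [g fK gK] fadj].
have sP := strand_of_bound conn fK gK fadj H_strand_P.
have sQ := strand_of_bound conn fK gK fadj H_strand_Q.
have sR := strand_of_bound conn fK gK fadj H_strand_R.
apply: (frame_pancyclic p0 q0 r0 _ _ sP sQ sR) => //.
- by case: hu => -[-> ->]; [left|right].
- have := uniq_H_vertices; rewrite -(map_inj_uniq (can_inj gK)).
  by rewrite !map_cat -!map_comp.
- by rewrite -card_H; apply: bij_eq_card; exists g.
Qed.

End FrameOfH.

Theorem theorem9 (R : realType) (G : sgraph) :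
  H_graph R G -> ~ isomorphic G K33 -> pancyclic G.
Proof.
move=> [conn _ [p [q [r [p0 q0 r0 [delG|delG]]]]]].
- by apply: edge_deletion_pancyclic conn delG => //; left.
- by apply: edge_deletion_pancyclic conn delG => //; right.
Qed.
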